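(* Let $h:\mathbf{C}\to\mathbf{C}$ be a transitive homeomorphism of the Cantor space and let $x\in\mathbf{C}$ be a point whose orbit under $h$ is dense in $\mathbf{C}$. Then there exist $\Phi=(\varphi^L,\varphi^U)$ such that $\mathbf{F}_\Phi$ is a Lelek fence and a homeomorphism $\hat h$ of $\mathbf{F}_\Phi$ such that (a) $h$ is the canonical factor of $\hat h$, i.e. $\hat h(y,t)=(h(y),s)$ for some $s$, for all $(y,t)\in\mathbf{F}_\Phi$; and (b) $(x,\varphi^U(x))$ is a transitive point of $\hat h$ (its orbit under $\hat h$ is dense in $\mathbf{F}_\Phi$).
   Context: For $\Phi=(\varphi^L,\varphi^U)$ with $\varphi^L,\varphi^U:\mathbf{C}\to[0,1]$, $\varphi^L$ lower semicontinuous, $\varphi^U$ upper semicontinuous, $\varphi^L\le\varphi^U$, the fence is $\mathbf{F}_\Phi=\{(x,t)\in\mathbf{C}\times[0,1]:\varphi^L(x)\le t\le\varphi^U(x)\}$. $\mathbf{F}_\Phi$ is a Lelek fence if $\varphi^L\equiv0$, $\varphi^U$ is positive on a dense subset of $\mathbf{C}$, and the graph $\{(x,\varphi^U(x)):x\in\mathbf{C}\}$ is dense in $\mathbf{F}_\Phi$. *)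

(* Defs.v *)
From HB Require Import structures.
From mathcomp Require Import all_boot all_order all_algebra.
From mathcomp Require Import all_classical all_reals all_analysis.
Set Implicit Arguments. Unset Strict Implicit. Unset Printing Implicit Defensive.
Import Order.TTheory GRing.Theory Num.Theory.
Import numFieldTopology.Exports.
Local Open Scope classical_set_scope.
Local Open Scope ring_scope.

Section Defs.
Context {R : realType}.

Definition lsc (f : cantor_space -> R) :=
  forall x (a : R), a < f x -> exists2 V, nbhs x V & forall y, V y -> a < f y.
Definition usc (f : cantor_space -> R) :=
  forall x (a : R), f x < a -> exists2 V, nbhs x V & forall y, V y -> f y < a.

Definition admissible_pair (phiL phiU : cantor_space -> R) :=
  [/\ forall x, 0 <= phiL x <= 1, forall x, 0 <= phiU x <= 1,
      lsc phiL, usc phiU & forall x, phiL x <= phiU x].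

Definition fence (phiL phiU : cantor_space -> R) : set (cantor_space * R) :=
  [set p | 0 <= p.2 <= 1 /\ phiL p.1 <= p.2 <= phiU p.1].

(* A is dense in the subspace F (A `<=` F assumed at use sites) *)
Definition dense_in {T : topologicalType} (A F : set T) := F `<=` closure A.

Definition graph_of (phi : cantor_space -> R) : set (cantor_space * R) :=
  [set (x, phi x) | x in setT].

Definition lelek_fence (phiL phiU : cantor_space -> R) :=
  [/\ forall x, phiL x = 0,
      dense [set x | 0 < phiU x] &
      dense_in (graph_of phiU) (fence phiL phiU)].

End Defs.

Definition homeo_on {T : topologicalType} (F : set T) (f : T -> T) :=
  exists g : T -> T,
    [/\ forall p, F p -> F (f p), forall p, F p -> F (g p),
        forall p, F p -> g (f p) = p, forall p, F p -> f (g p) = p &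
        {within F, continuous f} /\ {within F, continuous g}].

Definition homeo {T : topologicalType} (f : T -> T) := homeo_on setT f.

Definition dyn_orbit {T : Type} (f : T -> T) (x : T) : set T :=
  [set iter n f x | n in [set: nat]].

Definition top_transitive {T : topologicalType} (f : T -> T) :=
  forall U V : set T, open U -> open V -> U !=set0 -> V !=set0 ->
    exists n, (iter n f @` U) `&` V !=set0.

(* Main.v *)
Require Import Defs.
From HB Require Import structures.
From mathcomp Require Import all_boot all_order all_algebra.
From mathcomp Require Import all_classical all_reals all_analysis.
From mathcomp Require Import zify ring lra.
Import Order.TTheory GRing.Theory Num.Theory.
Import numFieldTopology.Exports.
Local Open Scope classical_set_scope.
Local Open Scope ring_scope.

(* Put phi^U = exp (- \sum_k v_k) with v_k >= 0 continuous and
   |v_k \o h - v_k| <= 2^-k.  As an infimum of continuous functions phi^U is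
   upper semicontinuous, while phi^U \o h = c phi^U where
   c = exp (- \sum_k (v_k \o h - v_k)) is continuous and positive, so that
   (y, t) |-> (h y, c y * t) is a homeomorphism of the fence sending the graph
   of phi^U to itself.  The v_k are chosen inductively, v_k vanishing at all the
   orbit points h^i x used before: at stage k one is given a basic open set V
   and a level s, and v_k lowers phi^U to the level s at some point of the orbit
   of x in V.  Running through all pairs (V, s) makes the orbit of (x, phi^U x)
   dense in the fence. *)

(** * Cylinders, clopen separation and perfect spaces *)

Definition cylinder (l : seq bool) : set cantor_space :=
  [set y | forall i, (i < size l)%N -> y i = nth false l i].

Lemma open_cylinder l : open (cylinder l).
Proof.
rewrite openE => y yl.
suff H n : (n <= size l)%N ->
    \forall z \near y, forall i, (i < n)%N -> z i = nth false l i.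
  exact: (H (size l)).
elim: n => [|n IH] nl; first by near=> z.
have nn := IH (ltnW nl).
have cn : (fun z : cantor_space => z n) @ y --> y n.
  exact: (@proj_continuous nat (fun=> bool) n y).
have yn : \forall z \near y, z n = y n.
  by apply: (cn [set y n]); rewrite nbhs_principalE; exact/principal_filterP.
near=> z => i; rewrite ltnS leq_eqVlt => /orP[/eqP ->|il].
  by rewrite -yl//; near: z.
by move: i il; near: z.
Unshelve. all: by end_near. Qed.

(** The cylinders given by initial segments of [y] generate a filter that converges to [y]
    coordinatewise, hence in the product topology; so it contains every neighbourhood of [y]. *)
Lemma nbhs_cylinder (y : cantor_space) (U : set cantor_space) : nbhs y U ->
  exists2 l, cylinder l y & cylinder l `<=` U.
Proof.
pose F := filter_from [set: nat]
  (fun n => [set z : cantor_space | forall i, (i < n)%N -> z i = y i]).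
have FF : Filter F.
  apply: filter_from_filter; first by exists 0%N.
  move=> i j _ _; exists (maxn i j) => // z zy; split=> k ki; apply: zy.
    exact: leq_trans ki (leq_maxl _ _).
  exact: leq_trans ki (leq_maxr _ _).
have Fy : {ptws, F --> y}.
  apply/pointwise_cvgP => i; apply: cvg_near_cst.
  by exists i.+1 => // z /(_ i); apply.
move=> /Fy[n _ nU]; exists (mkseq y n).
  by move=> i; rewrite size_mkseq => ni; rewrite nth_mkseq.
apply: subset_trans nU => z zl i ni.
by rewrite (zl i) ?size_mkseq// nth_mkseq.
Qed.

Lemma clopen_separate_finite (T : topologicalType) (w : T) (s : nat -> T) (n : nat) :
  zero_dimensional T -> (forall q, (q < n)%N -> w <> s q) ->
  exists W, [/\ clopen W, W w & forall q, (q < n)%N -> ~ W (s q)].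
Proof.
move=> T0; elim: n => [|n IH] ws; first by exists setT; split=> //; exact: clopenT.
have [q qn|W [cW Ww Ws]] := IH; first by apply: ws; exact: ltnW.
have /T0[U [cU Uw Us]] : w != s n by apply/eqP; exact: ws.
exists (W `&` U); split=> //; first exact: clopenI.
by move=> q; rewrite ltnS leq_eqVlt => /orP[/eqP -> []//|/Ws + []].
Qed.

(** By injectivity each [s q] has at most one preimage, and in a perfect space a nonempty open set
    keeps a point when that preimage is removed. *)
Lemma open_avoid_finite (T : topologicalType) (f : T -> T) (s : nat -> T)
    (n : nat) (O : set T) :
  perfect_set [set: T] -> accessible_space T -> continuous f -> injective f ->
  open O -> O !=set0 ->
  exists U, [/\ open U, U !=set0, U `<=` O &
    forall y q, (q < n)%N -> U y -> f y <> s q].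
Proof.
move=> pT aT cf fI oO O0; elim: n => [|n [U [oU U0 sUO aU]]].
  by exists O; split.
exists (U `&` f @^-1` (~` [set s n])); split.
- apply: openI => //; apply: open_comp; first by move=> *; exact: cf.
  by apply/closed_openC/accessible_closed_set1.
- have [y [z [Oy Oz yz]]] := perfectTP_ex.1 pT _ oU U0.
  have [fy|fy] := eqVneq (f y) (s n).
    exists z; split=> // /=; rewrite -fy => /fI /esym /eqP.
    by apply/negP.
  by exists y; split=> //; apply/eqP.
- by move=> y [/sUO].
- move=> y q; rewrite ltnS leq_eqVlt => /orP[/eqP -> []//|qn [/aU + _]].
  exact.
Qed.

(** * Bumps along orbit segments *)

Lemma continuous_indic_clopen (R : realType) (T : topologicalType) (W : set T) :
  clopen W -> continuous (\1_W : T -> R).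
Proof.
move=> [oW kW] y; apply: cvg_near_cst.
have [Wy|Wy] := pselect (W y).
  have := open_nbhs_nbhs (conj oW Wy); apply: filterS => z Wz.
  by rewrite !indicE !mem_set.
have := open_nbhs_nbhs (conj (closed_openC kW) Wy); apply: filterS => z Wz.
by rewrite !indicE !memNset.
Qed.

Lemma continuous_bigmax (R : realType) (T : topologicalType) (F : nat -> T -> R) n :
  (forall i, continuous (F i)) ->
  continuous (fun y => \big[Num.max/0]_(i < n) F i y).
Proof.
elim: n F => [|n IH] F cF y.
  by apply: cvg_near_cst; near=> z; rewrite !big_ord0.
have -> : (fun y => \big[Num.max/0]_(i < n.+1) F i y) =
  F 0%N \max (fun y => \big[Num.max/0]_(i < n) F i.+1 y).
  by apply/funext => z /=; rewrite big_ord_recl.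
by apply: continuous_max; [exact: cF|exact: (IH (fun i => F i.+1))].
Unshelve. all: by end_near. Qed.

Lemma continuous_iter (T : topologicalType) (h : T -> T) n :
  continuous h -> continuous (iter n h).
Proof.
move=> ch; elim: n => [|n IH] y; first exact: cvg_id.
by apply: (cvg_comp _ _ (IH y)); exact: ch.
Qed.

(* v y is the maximum over i of w i * \1_W (h^i y), where w is a tent of height A
   and slope e centred at L; it varies by at most e along h because w (i + 1)
   differs from w i by at most e and w vanishes at 0 and 2L.  Centring at L rather
   than 0 avoids negative iterates of h. *)
Lemma orbit_bump (R : realType) (T : topologicalType) (h : T -> T) (W : set T)
    (A e : R) (L : nat) :
  continuous h -> clopen W -> 0 <= A -> 0 < e -> A <= e * L%:R ->
  exists v : T -> R, [/\ continuous v, forall y, 0 <= v y,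
    forall y, `|v (h y) - v y| <= e,
    forall y, W (iter L h y) -> v y = A &
    forall y, (forall i, (i <= L.*2)%N -> ~ W (iter i h y)) -> v y = 0].
Proof.
move=> ch cW A0 e0 AL.
pose w i : R := Num.max 0 (A - e * `|i%:R - L%:R|).
have w_ge0 i : 0 <= w i by rewrite /w le_max lexx.
have w_le i : w i <= A.
  by rewrite ge_max A0 lerBlDr lerDl mulr_ge0// ltW.
have wS i : w i <= w i.+1 + e /\ w i.+1 <= w i + e.
  have H (a b : R) : `|a - b| <= 1 ->
      Num.max 0 (A - e * `|a|) <= Num.max 0 (A - e * `|b|) + e.
    rewrite distrC => ab.
    have m0 : 0 <= Num.max 0 (A - e * `|b|) by rewrite le_max lexx.
    have m1 : A - e * `|b| <= Num.max 0 (A - e * `|b|) by rewrite le_max lexx orbT.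
    rewrite ge_max; apply/andP; split; first by rewrite addr_ge0// ltW.
    have := ler_normD (b - a) a; rewrite subrK => tri.
    have : e * `|b| <= e * (1 + `|a|) by rewrite ler_pM2l//; lra.
    by rewrite mulrDr mulr1; lra.
  by split; apply: H; rewrite -natr1 ler_norml; apply/andP; split; lra.
have w0 : w 0%N = 0.
  by apply/max_idPl; rewrite sub0r normrN normr_nat subr_le0.
have w2L : w L.*2 = 0.
  apply/max_idPl; rewrite -addnn natrD addrK normr_nat subr_le0.
  exact: AL.
pose F i y : R := w i * \1_W (iter i h y).
have I01 y : 0 <= (\1_W y : R) <= 1.
  by rewrite indicE; case: (_ \in _); rewrite ler01 lexx.
have F_ge0 i y : 0 <= F i y by rewrite mulr_ge0//; case/andP: (I01 (iter i h y)).
have F_le i y : F i y <= w i.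
  by rewrite ler_piMr//; case/andP: (I01 (iter i h y)).
pose v y := \big[Num.max/0]_(i < L.*2.+1) F i y.
have Fv i y : (i <= L.*2)%N -> F i y <= v y.
  rewrite -ltnS => iL.
  exact: (le_bigmax _ (fun i : 'I_L.*2.+1 => F i y) (Ordinal iL)).
have v_ge0 y : 0 <= v y by exact: bigmax_ge_id.
exists v; split=> //.
- apply: continuous_bigmax => i y; apply: (@continuousM R T (cst (w i)) (\1_W \o iter i h)).
    exact: cvg_cst.
  by apply: continuous_comp; [exact: continuous_iter|exact: continuous_indic_clopen].
- move=> y; rewrite ler_norml lerBrDr addrC lerBlDr lerBlDr [e + _]addrC.
  have Fe i z : w i * \1_W z <= w i.+1 * \1_W z + e /\
                w i.+1 * \1_W z <= w i * \1_W z + e.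
    have [h1 h2] := wS i; rewrite !indicE; case: (_ \in _).
      by rewrite !mulr1.
    by rewrite !mulr0 add0r ltW.
  (* The point [h^(i+1) y] has weight [w i] in [F i (h y)] and [w i.+1] in [F i.+1 y]; the two
     unmatched end terms vanish. *)
  apply/andP; split; apply: bigmax_le => [|[i /= iL] _].
  + by rewrite addr_ge0// ltW.
  + case: i iL => [|i] iL.
      by rewrite /F w0 mul0r addr_ge0// ltW.
    have := (Fe i (iter i.+1 h y)).2; rewrite /F => /le_trans; apply.
    by rewrite lerD2r iterSr; apply: (Fv i); lia.
  + by rewrite addr_ge0// ltW.
  + have [iL'|iL'] := ltnP i L.*2; last first.
      have -> : i = L.*2 by lia.
      by rewrite /F w2L mul0r addr_ge0// ltW.
    have := (Fe i (iter i h (h y))).1; rewrite /F => /le_trans; apply.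
    by rewrite lerD2r -iterSr; apply: (Fv i.+1).
- move=> y Wy; apply/eqP; rewrite eq_le; apply/andP; split.
    by apply: bigmax_le => // i _; exact: le_trans (F_le _ _) (w_le _).
  have -> : A = F L y.
    rewrite /F indicE mem_set// mulr1 /w subrr normr0 mulr0 subr0.
    by apply/esym/max_idPr.
  by apply: Fv; lia.
- move=> y Wy; apply/eqP; rewrite eq_le v_ge0 andbT.
  apply: bigmax_le => // -[i iL] _ /=.
  by rewrite /F indicE memNset ?mulr0//; apply: Wy.
Qed.

(** * Inductive choice of the functions v_k *)

(** One stage, with [P] the sum of the earlier functions: a bump supported away from the orbit up to
    time [M] lifts [P] to [S] at an orbit point in [V]. As [v >= 0] can only raise [P], equality is
    claimed only if [P] is below [S] somewhere in [V]. *)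
Lemma orbit_adjust (R : realType) (T : topologicalType) (h : T -> T) (x : T)
    (P : T -> R) (V : set T) (S e : R) (M : nat) :
  perfect_set [set: T] -> hausdorff_space T -> zero_dimensional T ->
  continuous h -> injective h -> dense (dyn_orbit h x) ->
  continuous P -> (forall y, 0 <= P y) -> open V -> V !=set0 -> 0 <= S ->
  0 < e ->
  exists (v : T -> R) (n : nat), [/\ continuous v, forall y, 0 <= v y,
    forall y, `|v (h y) - v y| <= e,
    forall i, (i <= M)%N -> v (iter i h x) = 0 &
    [/\ V (iter n h x), S <= P (iter n h x) + v (iter n h x) &
      forall y, V y -> P y < S -> P (iter n h x) + v (iter n h x) = S]].
Proof.
move=> pT hT zT ch hI dx cP P0 oV V0 S0 e0.
(* If [P] is below [S] somewhere in [V], shrink [V] so that this holds throughout; then any orbit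
   point found there can be lifted exactly to [S]. *)
have [V' [oV' V'0 V'V V'P]] : exists V', [/\ open V', V' !=set0, V' `<=` V &
    forall y, V y -> P y < S -> forall z, V' z -> P z < S].
  have [[y Vy yS]|nex] := pselect (exists2 y, V y & P y < S).
    exists (V `&` P @^-1` [set a | a < S]); split => //.
    - apply: openI => //; apply: open_comp; last exact: open_lt.
      by move=> z _; exact: cP.
    - by exists y.
    - by move=> _ _ _ z [].
  by exists V; split=> // y Vy yS; exfalso; apply: nex; exists y.
have iI n : injective (iter n h).
  by elim: n => [|n IH] a b //= /hI /IH.
(* The bump must be at least S / e iterates wide to have slope e. *)
pose L := Num.Def.archi_bound (S / e).
have SL : S <= e * L%:R.
  by rewrite -ler_pdivrMl// mulrC ltW// archi_boundP// divr_ge0// ltW.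
(* The bump at [h^i x] depends on the points [h^(i+j) x] with [j <= L.*2]; for [i <= M] these times
   go up to [M + L.*2], and [W] must miss them all. *)
have [U [oU U0 UV Us]] := @open_avoid_finite T (iter L h)
  (fun q => iter q h x) (M + L.*2).+1 V' pT (hausdorff_accessible hT)
  (continuous_iter T h L ch) (iI L) oV' V'0.
have [z [Uz [m _ mz]]] := dx U U0 oU.
have [W [cW Wz Ws]] := @clopen_separate_finite T (iter L h z)
  (fun q => iter q h x) (M + L.*2).+1 zT (fun q qn => Us z q qn Uz).
have A0 : 0 <= Num.max 0 (S - P z) by rewrite le_max lexx.
have AL : Num.max 0 (S - P z) <= e * L%:R.
  apply: le_trans SL; rewrite ge_max S0.
  by rewrite lerBlDr lerDl P0.
have [v [cv v0 ve vA vz]] := orbit_bump R T h W _ e L ch cW A0 e0 AL.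
exists v, m; split=> //.
  move=> i iM; apply: vz => j jL; rewrite -iterD; apply: Ws; lia.
rewrite mz; split; first by apply: V'V; apply: UV.
- rewrite vA// addrC -lerBlDr le_max lexx orbT//.
- move=> y Vy yS; rewrite vA//.
  have /ltW zS := V'P y Vy yS z (UV z Uz).
  have /max_idPr -> : 0 <= S - P z by rewrite subr_ge0.
  by rewrite addrC subrK.
Qed.

(** Iterates [orbit_adjust], the bound [M] growing past every orbit time already used, so that later
    functions leave the values reached there unchanged. *)
Lemma orbit_adjust_sequence (R : realType) (T : topologicalType) (h : T -> T)
    (x : T) (V : nat -> set T) (S e : nat -> R) :
  perfect_set [set: T] -> hausdorff_space T -> zero_dimensional T ->
  continuous h -> injective h -> dense (dyn_orbit h x) ->
  (forall k, open (V k)) -> (forall k, V k !=set0) -> (forall k, 0 <= S k) ->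
  (forall k, 0 < e k) ->
  exists v : nat -> T -> R, [/\ forall k, continuous (v k),
    forall k y, 0 <= v k y,
    forall k y, `|v k (h y) - v k y| <= e k,
    forall k, v k x = 0 &
    forall k, exists n, [/\ V k (iter n h x),
      forall j, (k < j)%N -> v j (iter n h x) = 0,
      S k <= \sum_(i < k.+1) v i (iter n h x) &
      forall y, V k y -> \sum_(i < k) v i y < S k ->
        \sum_(i < k.+1) v i (iter n h x) = S k]].
Proof.
move=> pT hT zT ch hI dx oV V0 S0 e0.
pose adj (p : nat * ((T -> R) * nat)) (q : (T -> R) * nat) :=
  let P := p.2.1 in let v := q.1 in let z := iter q.2 h x in
  continuous P -> (forall y, 0 <= P y) ->
  [/\ continuous v, forall y, 0 <= v y,
    forall y, `|v (h y) - v y| <= e p.1,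
    forall i, (i <= p.2.2)%N -> v (iter i h x) = 0 &
    [/\ V p.1 z, S p.1 <= P z + v z &
      forall y, V p.1 y -> P y < S p.1 -> P z + v z = S p.1]].
(* The hypotheses on [P] sit inside [adj], so that a choice exists for every state; where they fail,
   [(P, 0%N)] is a dummy value. *)
have [f fP] : {f & forall p, adj p (f p)}.
  apply: choice => -[k [P M]].
  have [[cP P0]|nP] := pselect (continuous P /\ forall y, 0 <= P y); last first.
    by exists (P, 0%N); rewrite /adj /= => cP P0; case: (nP (conj cP P0)).
  have [v [n vn]] := orbit_adjust R T h x P (V k) (S k) (e k) M pT hT zT ch hI dx
    cP P0 (oV k) (V0 k) (S0 k) (e0 k).
  by exists (v, n).
(* The state before stage [k]: the sum of the earlier functions, and the largest orbit time used. *)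
pose st := fix st k : (T -> R) * nat := if k is k'.+1 then
    let p := st k' in let q := f (k', p) in
    (fun y => p.1 y + q.1 y, maxn p.2 q.2)
  else (fun=> 0, 0%N).
pose v k := (f (k, st k)).1.
have stE k y : (st k).1 y = \sum_(i < k) v i y.
  by elim: k => [|k IH]; rewrite ?big_ord0// big_ord_recr/= -IH.
have stI k : continuous (st k).1 /\ forall y, 0 <= (st k).1 y.
  elim: k => [|k [cP P0]]; first by split=> [y|//]; exact: cvg_cst.
  have [cv v0 _ _ _] := fP (k, st k) cP P0; split=> y.
    by apply: (@continuousD R R^o T (st k).1 (v k)); [exact: cP|exact: cv].
  by rewrite addr_ge0// ?P0 ?v0.
have M_le k j : (k <= j)%N -> ((st k).2 <= (st j).2)%N.
  move=> /subnK <-; elim: (j - k)%N => // d IH.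
  by rewrite (leq_trans IH)// addSn /= leq_maxl.
have vP k := fP (k, st k) (stI k).1 (stI k).2.
exists v; split=> [k|k|k|k|k]; try by have [] := vP k.
  by have [_ _ _ /(_ 0%N) + _] := vP k; apply.
have [_ _ _ _ [Vn Sn eqS]] := vP k.
exists (f (k, st k)).2; split => //.
- move=> j kj; have [_ _ _ + _] := vP j; apply.
  by rewrite (leq_trans _ (M_le _ _ kj))//= leq_maxr.
- by rewrite big_ord_recr/= -stE.
- by move=> y Vy yS; rewrite big_ord_recr/= -stE; apply: (eqS y); rewrite //= stE.
Qed.

(** * The limit function and its cocycle *)

Lemma continuous_series_geometric (R : realType) (T : topologicalType)
    (u : nat -> T -> R) :
  (forall k, continuous (u k)) -> (forall k y, `|u k y| <= geometric 1 2^-1 k) ->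
  exists2 D : T -> R, continuous D &
    forall y, \sum_(i < k) u i y @[k --> \oo] --> D y.
Proof.
move=> cu ub.
pose s k y := \sum_(i < k) u i y.
have cs k : continuous (s k).
  rewrite /s; elim: k => [|k IH] y.
    by apply: cvg_near_cst; near=> z; rewrite !big_ord0.
  have -> : (fun y => \sum_(i < k.+1) u i y) = (fun y => \sum_(i < k) u i y) \+ u k.
    by apply/funext => z; rewrite big_ord_recr.
  by apply: (@continuousD R R^o T); [exact: IH|exact: cu].
have h1 : `|2^-1 : R| < 1 by rewrite ger0_norm ?invr_ge0// invf_lt1// ltr1n.
have sD y : s k y @[k --> \oo] --> limn (s ^~ y).
  have -> : s ^~ y = series (u ^~ y).
    by apply/funext => k; rewrite /s /series/= big_mkord.
  apply: normed_cvg; apply: (@series_le_cvg R _ (geometric 1 2^-1)) => //.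
  - by move=> n; exact: normr_ge0.
  - by move=> n; rewrite /geometric/= mul1r exprn_ge0// invr_ge0.
  - by move=> n; exact: ub.
  - exact: is_cvg_geometric_series.
pose D y := limn (s ^~ y).
have tail n y : `|D y - s n y| <= 2 * 2^-1 ^+ n.
  (* Keeping the remainder [2 * 2^-1 ^+ (d + n)] on the right makes the induction on [d] close. *)
  have H d : `|s (d + n)%N y - s n y| <= 2 * 2^-1 ^+ n - 2 * 2^-1 ^+ (d + n).
    elim: d => [|d IH]; first by rewrite add0n !subrr normr0.
    have -> : s (d.+1 + n)%N y - s n y = (s (d + n)%N y - s n y) + u (d + n)%N y.
      by rewrite addSn /s big_ord_recr/= addrAC.
    apply: le_trans (ler_normD _ _) _; apply: le_trans (lerD IH (ub _ _)) _.
    rewrite /geometric/= addSn exprS mulrA divff// !mul1r.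
    have : 0 <= 2^-1 ^+ (d + n) :> R by rewrite exprn_ge0// invr_ge0.
    by lra.
  apply/ler_addgt0Pr => e e0.
  have /cvgrPdist_lt/(_ e e0)[N _ DN] := sD y.
  have := DN (N + n)%N (leq_addr _ _); rewrite -/(D y) => DN1.
  have := ler_normD (D y - s (N + n)%N y) (s (N + n)%N y - s n y).
  rewrite addrA subrK => /le_trans; apply.
  rewrite addrC lerD//; last exact: ltW.
  apply: le_trans (H N) _; rewrite gerBl mulr_ge0// exprn_ge0// invr_ge0//.
exists D => // y; apply/cvgrPdist_lt => e e0.
have e3 : 0 < e / 3 by rewrite divr_gt0.
have [n ne] : exists n, 2 * 2^-1 ^+ n < e / 3.
  have := @cvg_geometric R 2 2^-1 h1.
  move=> /cvgrPdist_lt/(_ (e / 3) e3)[N _ /(_ N (leqnn N))].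
  rewrite sub0r normrN ger0_norm; first by exists N.
  by rewrite mulr_ge0// exprn_ge0// invr_ge0.
have /cvgrPdist_lt/(_ (e / 3) e3) := cs n y.
apply: filterS => z sz.
have := tail n y; have := tail n z; rewrite [in X in X -> _]distrC => tz ty.
have := ler_normD (D y - s n y) (s n y - s n z).
have := ler_normD (D y - s n y + (s n y - s n z)) (s n z - D z).
have -> : D y - s n y + (s n y - s n z) + (s n z - D z) = D y - D z by ring.
by lra.
Unshelve. all: by end_near. Qed.

(** The sum of the v_k may diverge, and [phi] is 0 there, but the differences along [h] are summable
    uniformly, which makes [c] continuous and positive. The last clause is density of the orbit of
    [(x, phi x)] in the region under the graph. *)
Lemma recurrent_cocycle (R : realType) (T : topologicalType) (h : T -> T)
    (x : T) (B : nat -> set T) :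
  perfect_set [set: T] -> hausdorff_space T -> zero_dimensional T ->
  (forall k, open (B k)) -> (forall k, B k !=set0) ->
  (forall y U, nbhs y U -> exists2 k, B k y & B k `<=` U) ->
  continuous h -> injective h -> dense (dyn_orbit h x) ->
  exists phi c : T -> R,
    [/\ [/\ forall y, 0 <= phi y <= 1, phi x = 1 &
        forall y a, phi y < a -> \forall z \near y, phi z < a],
      continuous c, forall y, 0 < c y, forall y, phi (h y) = c y * phi y &
      forall y t (U : set T) e, 0 <= t <= phi y -> nbhs y U -> 0 < e ->
        exists n, U (iter n h x) /\ `|t - phi (iter n h x)| < e].
Proof.
move=> pT hT zT oB B0 bB ch hI dx.
(* Enumerates all pairs of a basic open set and a rational; the absolute value in [S] makes every
   level nonnegative. *)
pose task k : nat * rat := odflt (0%N, 0) (unpickle k).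
pose S k : R := `|ratr (task k).2|.
have [v [cv v0 vh vx vn]] := orbit_adjust_sequence R T h x
  (fun k => B (task k).1) S (geometric 1 2^-1) pT hT zT ch hI dx
  (fun k => oB _) (fun k => B0 _) (fun k => normr_ge0 _)
  (fun k => ltac:(by rewrite /geometric/= mul1r exprn_gt0// invr_gt0)).
pose Psi k y := \sum_(i < k) v i y.
have PsiS k y : Psi k.+1 y = Psi k y + v k y by rewrite /Psi big_ord_recr.
have cPsi k : continuous (Psi k).
  elim: k => [|k IH] y.
    by apply: cvg_near_cst; near=> z; rewrite /Psi !big_ord0.
  have -> : Psi k.+1 = Psi k \+ v k by apply/funext => z; rewrite PsiS.
  by apply: (@continuousD R R^o T); [exact: IH|exact: cv].
have Psi_le y k j : (k <= j)%N -> Psi k y <= Psi j y.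
  move=> /subnK <-; elim: (j - k)%N => // d IH.
  by rewrite addSn PsiS (le_trans IH)// lerDl.
have [D cD PsiD] := @continuous_series_geometric R T (fun k y => v k (h y) - v k y)
  (fun k y => @continuousB R R^o T (v k \o h) (v k) y
     (continuous_comp (ch y) (cv k (h y))) (cv k y)) vh.
pose E y k := expR (- Psi k y).
pose phi y := inf (range (E y)).
have E_ge0 y : has_lbound (range (E y)).
  by exists 0 => _ [k _ <-]; exact: expR_ge0.
have E0 y : range (E y) !=set0 by exists (E y 0%N), 0%N.
have E_le y k j : (k <= j)%N -> E y j <= E y k.
  by move=> kj; rewrite ler_expR lerN2 Psi_le.
have phi_le y k : phi y <= E y k by apply: ge_inf => //; exists k.
have phi_cvg y : E y k @[k --> \oo] --> phi y.
  by apply: nonincreasing_cvgn => // k j kj; exact: E_le.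
have phiE y k : (forall j, (k <= j)%N -> v j y = 0) -> phi y = E y k.
  move=> vy; apply/eqP; rewrite eq_le phi_le/=.
  apply: lb_le_inf => // _ [j _ <-].
  have [kj|jk] := leqP k j; last exact/E_le/ltnW.
  rewrite ler_expR lerN2 -(subnK kj); elim: (j - k)%N => // d IH.
  by rewrite addSn PsiS vy ?leq_addl// addr0.
pose c y := expR (- D y).
exists phi, c; split.
- split.
  + move=> y; rewrite lb_le_inf//=; last by move=> _ [k _ <-]; exact: expR_ge0.
    by rewrite (le_trans (phi_le y 0%N))// /E /Psi big_ord0 oppr0 expR0.
  + by rewrite (phiE x 0%N) => [|j _ //]; rewrite /E /Psi big_ord0 oppr0 expR0.
  + move=> y a /(inf_lt (E0 y))[_ [k _ <-]] Ea.
    have cE : continuous (fun z => E z k).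
      move=> z; apply: (@continuous_comp _ _ _ (fun z => - Psi k z) expR).
        exact: (@continuousN R R^o T (Psi k) z (cPsi k z)).
      exact: continuous_expR.
    have : \forall z \near y, E z k < a.
      by apply: (cE y [set b | b < a]); apply: open_nbhs_nbhs; split=> //; exact: open_lt.
    by apply: filterS => z; exact: le_lt_trans.
- move=> y; apply: (@continuous_comp _ _ _ (fun z => - D z) expR).
    exact: (@continuousN R R^o T D y (cD y)).
  exact: continuous_expR.
- by move=> y; exact: expR_gt0.
(* The identity holds for the partial products, and passing to the limit also covers the points
   where [phi] is 0. *)
- move=> y; apply: (@cvg_unique R (@norm_hausdorff R R) _ _ _ _ (phi_cvg (h y))).
  have -> : E (h y) = (fun k => expR (- \sum_(i < k) (v i (h y) - v i y)) * E y k).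
    apply/funext => k; rewrite /E -expRD; congr expR.
    by rewrite sumrB /Psi opprB addrAC subrr sub0r.
  apply: (@cvgM R nat \oo _ (fun k => expR (- \sum_(i < k) (v i (h y) - v i y))) (E y)
    (c y) (phi y)) => //.
  have PsiDN : - \sum_(i < k) (v i (h y) - v i y) @[k --> \oo] --> - D y.
    by apply: (@cvgN R R nat \oo); exact: PsiD.
  exact: (cvg_comp _ expR PsiDN (@continuous_expR R (- D y))).
- move=> y t U e /andP[t0 ty] Uy e0.
  have [i Biy BiU] := bB y U Uy.
  have adjust q : exists n, [/\ U (iter n h x),
      phi (iter n h x) <= expR (- `|ratr q|) &
      expR (- `|ratr q|) < phi y -> phi (iter n h x) = expR (- `|ratr q|)].
    pose k := pickle (i, q).
    have taskk : task k = (i, q) by rewrite /task pickleK.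
    have [n [Bn vn0 Sn eqS]] := vn k; exists n.
    move: Bn Sn eqS; rewrite /S taskk/= => Bn Sn eqS.
    have -> : phi (iter n h x) = E (iter n h x) k.+1 by exact: phiE.
    split; first exact: BiU.
      by rewrite ler_expR lerN2.
    move=> /lt_le_trans/(_ (phi_le y k)); rewrite ltr_expR ltrN2 => Py.
    by rewrite /E /Psi (eqS y).
  have [t_gt0|t_le0] := ltP 0 t; last first.
    have tE : t = 0 by apply/eqP; rewrite eq_le t_le0.
    have [q] := @rat_in_itvoo R `|ln e| (`|ln e| + 1) ltac:(by rewrite ltrDl).
    rewrite in_itv/= => /andP[qe _].
    have [n [Un phin _]] := adjust q; exists n; split => //.
    have phi0 : 0 <= phi (iter n h x) by apply: lb_le_inf => // _ [k _ <-]; exact: expR_ge0.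
    rewrite tE sub0r normrN ger0_norm// (le_lt_trans phin)// -[ltRHS]lnK//.
    rewrite ltr_expR ltrNl (lt_le_trans _ (ler_norm _))// (le_lt_trans _ qe)//.
    by rewrite -normrN ler_norm.
  (* A positive lower bound within [e] of [t], so that [ln m] is meaningful; then [q] is taken with
     [expR (- ratr q)] strictly between [m] and [t], hence below [phi y]. *)
  pose m := Num.max (t - e) (t / 2).
  have m0 : 0 < m by rewrite lt_max divr_gt0// orbT.
  have mt : m < t by rewrite gt_max; apply/andP; split; lra.
  have te : t - e <= m by rewrite le_max lexx.
  have [q] := @rat_in_itvoo R (- ln t) (- ln m) ltac:(by rewrite ltrN2 ltr_ln).
  rewrite in_itv/= => /andP[qt qm].
  have t1 : t <= 1.
    by rewrite (le_trans ty)// (le_trans (phi_le y 0%N))// /E /Psi big_ord0 oppr0 expR0.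
  have q0 : 0 <= ratr q :> R by rewrite (le_trans _ (ltW qt))// oppr_ge0 ln_le0.
  have [n [Un _]] := adjust q; rewrite ger0_norm// => phin; exists n; split => //.
  have qt' : expR (- ratr q) < t by rewrite -[ltRHS]lnK// ltr_expR ltrNl.
  have qm' : m < expR (- ratr q) by rewrite -[ltLHS]lnK// ltr_expR ltrNr.
  by rewrite phin ?(lt_le_trans qt')// ger0_norm; lra.
Unshelve. all: by end_near. Qed.

(** * The skew product on the fence *)

Lemma continuous_skew_product (R : realType) (T : topologicalType) (f : T -> T)
    (c : T -> R) : continuous f -> continuous c ->
  continuous (fun p : T * R => (f p.1, c p.1 * p.2)).
Proof.
move=> cf cc p.
have c1 : p'.1 @[p' --> p] --> p.1 by exact: cvg_fst.
have c2 : p'.2 @[p' --> p] --> p.2 by exact: cvg_snd.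
apply: (@cvg_pair _ _ _ (nbhs p) (nbhs (f p.1)) (nbhs (c p.1 * p.2))).
  exact: (cvg_comp _ f c1 (cf p.1)).
exact: (cvgM (cvg_comp _ c c1 (cc p.1)) c2).
Qed.

Lemma continuous_within_setT (T U : topologicalType) (f : T -> U) :
  {within [set: T], continuous f} -> continuous f.
Proof.
move=> cf y V fV.
have : nbhs (y : subspace [set: T]) (f @^-1` V) by exact: cf.
by rewrite nbhs_subspaceT.
Qed.

Theorem theorem7p1 (R : realType) (h : cantor_space -> cantor_space)
  (x : cantor_space) :
  homeo h -> top_transitive h -> dense (dyn_orbit h x) ->
  exists (phiL phiU : cantor_space -> R) (hh : cantor_space * R -> cantor_space * R),
    [/\ admissible_pair phiL phiU,
        lelek_fence phiL phiU,
        homeo_on (fence phiL phiU) hh,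
        (forall y t, fence phiL phiU (y, t) -> exists s, hh (y, t) = (h y, s)) &
        dense_in (dyn_orbit hh (x, phiU x)) (fence phiL phiU)].
Proof.
move=> [g [_ _ gh hg [ch cg]]] _ dx.
have {}ch : continuous h by exact: continuous_within_setT.
have {}cg : continuous g by exact: continuous_within_setT.
have {}gh y : g (h y) = y by exact: gh.
have {}hg y : h (g y) = y by exact: hg.
pose B k := cylinder (odflt [::] (unpickle k)).
have [||y U yU|phi [c [[phi01 phix usc_phi] cc c0 phih dphi]]] :=
    @recurrent_cocycle R cantor_space h x B cantor_perfect cantor_space_hausdorff
      cantor_zero_dimensional _ _ _ ch (can_inj gh) dx.
- by move=> k; exact: open_cylinder.
- by move=> k; exists (nth false (odflt [::] (unpickle k))) => i.
- have [l yl lU] := nbhs_cylinder y U yU.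
  by exists (pickle l); rewrite /B pickleK.
pose hh (p : cantor_space * R) := (h p.1, c p.1 * p.2).
have orbE n : iter n hh (x, phi x) = (iter n h x, phi (iter n h x)).
  by elim: n => [//|n IH]; rewrite !iterS IH /hh /= phih.
have phi_gt0 n : 0 < phi (iter n h x).
  elim: n => [|n IH]; first by rewrite /= phix.
  by rewrite iterS phih mulr_gt0.
have fenceE y t : fence (fun=> 0) phi (y, t) <-> 0 <= t <= phi y.
  split=> [[_ //]|/andP[t0 ty]]; split=> /=; rewrite t0//=.
  by rewrite (le_trans ty)//; have /andP[] := phi01 y.
(* This orbit lies on the graph of [phi] by [orbE], so its density also gives the density of the
   graph required of a Lelek fence. *)
have orb_dense : dense_in (dyn_orbit hh (x, phi x)) (fence (fun=> 0) phi).
  move=> [y t] /fenceE yt W [[U A] [/= Uy At] UAW].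
  have [e /= e0 eA] := At.
  have [n [Un tn]] := dphi y t U e yt Uy e0.
  exists (iter n hh (x, phi x)); split; first by exists n.
  by rewrite orbE; apply: UAW; split => //=; apply: eA.
exists (fun=> 0), phi, hh; split => //.
- split=> //.
  + by move=> _; rewrite lexx ler01.
  + by move=> y a a0; exists setT => //; exact: filterT.
  + by move=> y a /usc_phi ya; exists [set z | phi z < a].
  + by move=> y; have /andP[] := phi01 y.
- split=> //.
  + move=> O O0 oO; have [z [Oz [n _ nz]]] := dx O O0 oO.
    by exists z; split=> //=; rewrite -nz.
  + move=> p /orb_dense; apply: closureS => _ [n _ <-].
    by rewrite orbE; exists (iter n h x).
(* The inverse divides by the factor [c] taken at the preimage [g y]. *)
- exists (fun p => (g p.1, (c (g p.1))^-1 * p.2)); split.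
  + move=> [y t] /fenceE/andP[t0 ty]; apply/fenceE => /=.
    by rewrite phih mulr_ge0 ?ler_pM2l// ltW.
  + move=> [y t] /fenceE/andP[t0 ty]; apply/fenceE => /=.
    rewrite mulr_ge0 ?invr_ge0 ?(ltW (c0 _))//=.
    by rewrite ler_pdivrMl// -phih hg.
  + by move=> [y t] _; rewrite /hh /= gh mulKf// gt_eqF.
  + by move=> [y t] _; rewrite /hh /= hg mulVKf// gt_eqF.
  + split; apply: continuous_subspaceT.
      exact: (@continuous_skew_product R cantor_space h c).
    apply: (@continuous_skew_product R cantor_space g (fun y => (c (g y))^-1)) => //.
    move=> y; apply: (@cvgV R cantor_space (nbhs y) _ (c \o g) (c (g y))).
      by rewrite gt_eqF.
    exact: (cvg_comp _ c (cg y) (cc (g y))).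
- by move=> y t _; exists (c y * t).
Qed.
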